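(* Let $T:[0,1)\to[0,1)$ be the Gauss map. Then there exists a scrambled set $S\subseteq[0,1)$ of $T$ (with respect to the usual metric $|x-y|$) whose Hausdorff dimension is $1$.
   Context: The Gauss map $T:[0,1)\to[0,1)$ is defined by $T(0)=0$ and $T(x)=\frac1x-\lfloor \frac1x\rfloor$ for $x\in(0,1)$. Let $(X,\rho)$ be a metric space and $f:X\to X$ a map. A pair $(x,y)\in X\times X$ is a scrambled pair for $f$ if $\limsup_{n\to\infty}\rho(f^n(x),f^n(y))>0$ and $\liminf_{n\to\infty}\rho(f^n(x),f^n(y))=0$. A subset $S\subseteq X$ containing at least two points is a scrambled set of $f$ if for all $x,y\in S$ with $x\ne y$, $(x,y)$ is a scrambled pair for $f$. *)

(* Defs.v *)
From HB Require Import structures.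
From mathcomp Require Import all_boot all_order all_algebra.
From mathcomp Require Import all_classical all_reals all_analysis.

Set Implicit Arguments.
Unset Strict Implicit.
Unset Printing Implicit Defensive.

Import Order.TTheory GRing.Theory Num.Theory.
Import numFieldNormedType.Exports.

Local Open Scope classical_set_scope.
Local Open Scope ring_scope.

Section scrambled.
Context {R : realType} {M : metricType R}.

(* The metric space is the subspace X of M, and f : X -> X. Values of f outside
   X are irrelevant, since f maps X to itself. Limsup and liminf are taken in
   the extended reals, where they always exist. *)
Definition scrambled_pair (X : set M) (f : {fun X >-> X}) (x y : M) : Prop :=
  (0 < limn_esup (fun n => (mdist (iter n f x) (iter n f y))%:E))%E /\
  limn_einf (fun n => (mdist (iter n f x) (iter n f y))%:E) = 0%E.

Definition scrambled_set (X : set M) (f : {fun X >-> X}) (S : set M) : Prop :=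
  [/\ S `<=` X,
      exists x y, [/\ S x, S y & x != y] &
      forall x y, S x -> S y -> x != y -> scrambled_pair f x y].

End scrambled.

Section hausdorff.
Context {R : realType} {M : metricType R}.
Local Open Scope ereal_scope.

(* The maximum with 0 matters only for U = set0, where the supremum is -oo. *)
Definition diam (U : set M) : \bar R :=
  maxe 0 (ereal_sup [set (mdist p.1 p.2)%:E | p in U `*` U]).

(* For s = 0 a nonempty set of diameter 0 has weight 0 `^ 0 = 1, and the empty
   set has weight 0, so that the 0-dimensional measure counts points. *)
Definition diam_weight (s : R) (U : set M) : \bar R :=
  if U == set0 then 0 else poweR (diam U) s.

Definition hausdorff_premeasure (s delta : R) (A : set M) : \bar R :=
  ereal_inf [set \sum_(0 <= i <oo) diam_weight s (U i) | U in
    [set U : (set M)^nat |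
      A `<=` \bigcup_i U i /\ forall i, diam (U i) <= delta%:E]].

(* The premeasure is nonincreasing in delta, so this supremum is its limit as
   delta tends to 0. *)
Definition hausdorff_measure (s : R) (A : set M) : \bar R :=
  ereal_sup [set hausdorff_premeasure s delta A | delta in
    [set delta : R | (0 < delta)%R]].

Definition hausdorff_dim (A : set M) : \bar R :=
  ereal_inf [set s%:E | s in
    [set s : R | (0 <= s)%R /\ hausdorff_measure s A = 0]].

End hausdorff.

Section gauss.
Context {R : realType}.

(* R^o is R with the metric induced by the absolute value. *)
Lemma mdist_realE (x y : R^o) : mdist x y = `|x - y|.
Proof. exact: distrC. Qed.

Definition gauss_map (x : R^o) : R^o :=
  if x == 0 then 0 else x^-1 - (Num.floor x^-1)%:~R.

Lemma gauss_map_fun : set_fun `[0, 1[%classic `[0, 1[%classic gauss_map.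
Proof.
move=> x _; rewrite /gauss_map /= in_itv /=.
case: ifP => _; first by rewrite lexx ltr01.
by rewrite subr_ge0 floor_le /= ltrBlDl -intrD1 floorD1_gt.
Qed.

HB.instance Definition _ :=
  isFun.Build R^o R^o `[0, 1[%classic `[0, 1[%classic gauss_map gauss_map_fun.

End gauss.

(* Main.v *)
(* Choose digit bounds m_n growing so fast that the set A of points whose n-th
   partial quotient is at most m_n has positive Lebesgue measure, yet only
   polynomially. Into the expansion of x in A insert, at very sparse places, the
   blocks a_j 1^k, where a_j is a digit of x that has already been read, k tends
   to infinity and every index j recurs. The images of two distinct points of A
   come arbitrarily close (in the runs of ones) and are infinitely often a fixed
   distance apart (just before the copy of a digit in which they differ), so the
   set S of images is scrambled. The blocks change the denominators q_n by
   polynomial factors only, while q_n grows exponentially; hence the map from S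
   back to A is s-Hoelder for every s < 1, and a cover of S of small
   s-dimensional weight would give a cover of A of small total length. *)
Require Import Defs.
From mathcomp Require Import all_boot all_order all_algebra.
From mathcomp Require Import all_classical all_reals all_analysis.
From mathcomp Require Import zify ring lra.
Import Order.TTheory GRing.Theory Num.Theory.
Import numFieldNormedType.Exports.

Set Implicit Arguments.
Unset Strict Implicit.
Unset Printing Implicit Defensive.

Local Open Scope classical_set_scope.
Local Open Scope ring_scope.

(** * Finite continued fractions *)

Section continued_fraction.
Context {R : realType}.
Implicit Types (w v : seq nat) (t : R) (a n : nat).

(** With the tail [t] kept as a variable, [cf w] is, for positive digits, the inverse branch of the
    iterated Gauss map that belongs to the digits [w]. *)
Definition cf w t : R := foldr (fun a r => (a%:R + r)^-1) t w.

(* The denominator of the Moebius map [cf w], normalised so that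
   [cf w t * cf_den w t] is affine in [t]; [cf_den w 0] is the usual q_n. *)
Fixpoint cf_den w t : R :=
  if w is a :: w' then (a%:R + cf w' t) * cf_den w' t else 1.

Definition posw w := all (fun a => 0 < a)%N w.

Lemma cf_cat w v t : cf (w ++ v) t = cf w (cf v t).
Proof. by rewrite /cf foldr_cat. Qed.

Lemma cf_rcons w a t : cf (rcons w a) t = cf w (a%:R + t)^-1.
Proof. by rewrite -cats1 cf_cat. Qed.

Lemma cf_den_cat w v t : cf_den (w ++ v) t = cf_den w (cf v t) * cf_den v t.
Proof. by elim: w => [|a w IH] /=; rewrite ?mul1r// IH cf_cat mulrA. Qed.

Lemma cf_ge0 w t : 0 <= t -> 0 <= cf w t.
Proof. by move=> t0; elim: w => [//|a w IH] /=; rewrite invr_ge0 addr_ge0. Qed.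

Lemma cf_itv w t : posw w -> 0 <= t <= 1 -> 0 <= cf w t <= 1.
Proof.
case: w => [//|a w] /= /andP[a0 _] /andP[t0 _].
have c0 := cf_ge0 w t0.
have a1 : 1 <= a%:R :> R by rewrite ler1n.
rewrite invr_ge0 addr_ge0 //=.
by rewrite invf_le1; lra.
Qed.

Lemma cf_den_gt0 w t : posw w -> 0 <= t -> 0 < cf_den w t.
Proof.
move=> + t0; elim: w => [_ //=|a w IH] /= /andP[a0 /IH ?].
by rewrite mulr_gt0// ltr_wpDr ?cf_ge0// ltr0n.
Qed.

Lemma cf_sub w t t' : posw w -> 0 <= t -> 0 <= t' ->
  `|cf w t - cf w t'| = `|t - t'| / (cf_den w t * cf_den w t').
Proof.
move=> + t0 t'0; elim: w => [_|a w IH] /=; first by rewrite mulr1 divr1.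
move=> /andP[a0 w0].
have D := cf_den_gt0 w0 t0; have D' := cf_den_gt0 w0 t'0.
have c0 := cf_ge0 w t0; have c0' := cf_ge0 w t'0.
have a0' : 0 < a%:R :> R by rewrite ltr0n.
have -> : (a%:R + cf w t)^-1 - (a%:R + cf w t')^-1 =
  - (cf w t - cf w t') / ((a%:R + cf w t) * (a%:R + cf w t')).
  field; apply/andP; split; apply: lt0r_neq0; lra.
rewrite normrM normrN IH// normfV (ger0_norm (_ : 0 <= (_ * _)))//; last first.
  by rewrite mulr_ge0// addr_ge0.
by field; rewrite !lt0r_neq0//; lra.
Qed.

(** Prepending a digit turns the old denominator into the new numerator and makes the new
    denominator a combination of both, so the two affine formulas are proved together. *)
Lemma cf_den_affine w t : posw w -> 0 <= t ->
  cf_den w t = cf_den w 0 + t * (cf_den w 1 - cf_den w 0) /\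
  cf w t * cf_den w t = cf w 0 * cf_den w 0 +
    t * (cf w 1 * cf_den w 1 - cf w 0 * cf_den w 0).
Proof.
move=> + t0; elim: w => [_ /=|a w IH]; first by split; ring.
move=> /= /andP[a0 w0]; have [IH1 IH2] := IH w0.
have a0' : 0 < a%:R :> R by rewrite ltr0n.
have ne x : 0 <= x -> a%:R + cf w x != 0.
  by move=> x0; rewrite lt0r_neq0// ltr_wpDr ?cf_ge0.
rewrite !mulrA !mulVf ?ne// !mul1r; split; last exact: IH1.
rewrite !mulrDl IH2 IH1; ring.
Qed.

(** At [t = 0] this is the recurrence q_{n+1} = a q_n + q_{n-1}: the slope [cf_den w 1 - cf_den w 0]
    is q_{n-1}. *)
Lemma cf_den_rcons w a t : posw w -> (0 < a)%N -> 0 <= t ->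
  cf_den (rcons w a) t =
    (a%:R + t) * cf_den w 0 + (cf_den w 1 - cf_den w 0).
Proof.
move=> w0 a0 t0; have a0' : 0 < a%:R :> R by rewrite ltr0n.
rewrite -cats1 cf_den_cat /= mulr1 (cf_den_affine w0 _).1; last first.
  by rewrite invr_ge0 addr_ge0.
by field; rewrite lt0r_neq0//; lra.
Qed.

Lemma cf_den1 w : posw w ->
  [/\ 1 <= cf_den w 0, cf_den w 0 <= cf_den w 1 & cf_den w 1 <= 2 * cf_den w 0].
Proof.
elim/last_ind: w => [_|w a IH] /=; first by split; lra.
rewrite /posw all_rcons => /andP[a0 w0]; have [h1 h2 h3] := IH w0.
rewrite !cf_den_rcons//.
have : 1 <= a%:R :> R by rewrite ler1n.
by split; nra.
Qed.

Lemma cf_den_bounds w t : posw w -> 0 <= t <= 1 ->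
  cf_den w 0 <= cf_den w t <= 2 * cf_den w 0.
Proof.
move=> w0 /andP[t0 t1]; rewrite (cf_den_affine w0 t0).1.
by have [h1 h2 h3] := cf_den1 w0; apply/andP; split; nra.
Qed.

Lemma cf_den_ge1 w : posw w -> 1 <= cf_den w 0.
Proof. by case/cf_den1. Qed.

(** In [cf_den_cat] the first factor is evaluated at a tail in [0, 1], where it varies by a factor
    of at most 2. *)
Lemma cf_den_cat_bounds w v : posw w -> posw v ->
  cf_den w 0 * cf_den v 0 <= cf_den (w ++ v) 0 <=
  2 * cf_den w 0 * cf_den v 0.
Proof.
move=> w0 v0; rewrite cf_den_cat.
have /andP[] : 0 <= cf v 0 <= 1 by apply: cf_itv => //; rewrite lexx ler01.
have vpos := cf_den_ge1 v0.
move=> c0 c1.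
have /(_ _)/andP[|h1 h2] := @cf_den_bounds w (cf v 0) w0; first by rewrite c0.
by rewrite !ler_wpM2r//; lra.
Qed.

(** A single digit 1 may leave the denominator unchanged, so digits are taken in pairs: a pair
    contributes [a * b + 1 >= 2]. *)
Lemma cf_den_ge_pow w : posw w -> 2 ^+ (size w)./2 <= cf_den w 0.
Proof.
have [n] := ubnP (size w); elim: n => // n IH in w *.
case: w => [|a [|b w]] sw w0; first by rewrite expr0.
  by rewrite expr0 cf_den_ge1.
have /= /andP[a0 /andP[b0 w0']] := w0.
have hab : posw [:: a; b] by rewrite /= a0 b0.
have /andP[h _] := cf_den_cat_bounds hab w0'.
apply: le_trans h; rewrite /= exprS; apply: ler_pM => //.
- have a1 : 1 <= a%:R :> R by rewrite ler1n.
  have b1 : 1 <= b%:R :> R by rewrite ler1n.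
  rewrite addr0 mulr1 mulrDl mulVf; last by rewrite lt0r_neq0//; lra.
  nra.
- by apply: IH => //; move: sw => /=; lia.
Qed.

Lemma cf_den_sqr_ge w : posw w -> 2 ^+ size w <= 2 * cf_den w 0 ^+ 2.
Proof.
move=> w0; have q1 := cf_den_ge_pow w0.
have p0 : 0 <= 2 ^+ (size w)./2 :> R by rewrite exprn_ge0.
apply: (@le_trans _ _ (2 * (2 ^+ (size w)./2) ^+ 2)).
  rewrite -exprM -exprS ler_eXn2l ?ltr1n//.
  by move: (odd_double_half (size w)); case: odd; lia.
by rewrite ler_pM2l// !expr2; nra.
Qed.

Lemma cf_dist_le w t t' : posw w -> 0 <= t <= 1 -> 0 <= t' <= 1 ->
  `|cf w t - cf w t'| <= `|t - t'| / cf_den w 0 ^+ 2.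
Proof.
move=> w0 ht ht'; have /andP[t0 _] := ht; have /andP[t'0 _] := ht'.
rewrite cf_sub//; have q1 := cf_den_ge1 w0.
have /andP[h1 _] := cf_den_bounds w0 ht; have /andP[h2 _] := cf_den_bounds w0 ht'.
rewrite ler_wpM2l// lef_pV2 ?posrE; last 2 first.
- by rewrite mulr_gt0//; lra.
- by rewrite exprn_gt0//; lra.
by rewrite expr2; nra.
Qed.

Lemma cf_dist_ge w t t' : posw w -> 0 <= t <= 1 -> 0 <= t' <= 1 ->
  `|t - t'| / (4 * cf_den w 0 ^+ 2) <= `|cf w t - cf w t'|.
Proof.
move=> w0 ht ht'; have /andP[t0 _] := ht; have /andP[t'0 _] := ht'.
rewrite cf_sub//; have q1 := cf_den_ge1 w0.
have /andP[h1 h1'] := cf_den_bounds w0 ht.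
have /andP[h2 h2'] := cf_den_bounds w0 ht'.
rewrite ler_wpM2l// lef_pV2 ?posrE; last 2 first.
- by rewrite mulr_gt0//; nra.
- by rewrite mulr_gt0//; lra.
by rewrite expr2; nra.
Qed.

Lemma cf_dist_le_pow w t t' : posw w -> 0 <= t <= 1 -> 0 <= t' <= 1 ->
  `|cf w t - cf w t'| <= 2 * 2^-1 ^+ size w.
Proof.
move=> w0 ht ht'; apply: le_trans (cf_dist_le w0 ht ht') _.
have q1 := cf_den_ge1 w0.
have hn : `|t - t'| <= 1 by rewrite ler_norml; lra.
have h4 := cf_den_sqr_ge w0.
have p2 : 0 < 2 ^+ size w :> R by rewrite exprn_gt0.
have q2 : 0 < cf_den w 0 ^+ 2 by nra.
rewrite exprVn ler_pdivrMr// mulrAC ler_pdivlMr//.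
nra.
Qed.

End continued_fraction.

(** * Infinite continued fractions and the Gauss map *)

Section infinite_continued_fraction.
Context {R : realType}.
Implicit Types (c : nat -> nat) (x : R) (n : nat).

Definition posseq c := forall i, (0 < c i)%N.

Definition shiftn n c : nat -> nat := fun i => c (n + i)%N.

Definition cfr c : R := limn (fun n => cf (mkseq c n) 0 : R).

Lemma posseq_shiftn n c : posseq c -> posseq (shiftn n c).
Proof. by move=> c0 i; exact: c0. Qed.

Lemma shiftn1_shiftn n c : shiftn 1 (shiftn n c) = shiftn n.+1 c.
Proof. by apply/funext => i; rewrite /shiftn add1n addnS addSn. Qed.

Lemma posw_mkseq c n : posseq c -> posw (mkseq c n).
Proof. by move=> c0; apply/allP => a /mapP[i _ ->]. Qed.

Lemma mkseq_shiftn1 c n : mkseq c n.+1 = c 0 :: mkseq (shiftn 1 c) n.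
Proof. by rewrite /mkseq /= -addn1 addnC iotaDl -map_comp. Qed.

Lemma geometric2_small (e : R) : 0 < e -> exists n, 2 * 2^-1 ^+ n < e.
Proof.
move=> e0; have := @upper_nthrootP R (2 / e) _ (leqnn _).
set n := Num.bound _ => h; exists n.
by rewrite exprVn ltr_pdivrMr ?exprn_gt0// mulrC -ltr_pdivrMr.
Qed.

Lemma cf_mkseq_cvg c : posseq c -> cvgn (fun n => cf (mkseq c n) 0 : R).
Proof.
move=> c0; pose u n : R := cf (mkseq c n) 0.
have cvs : cvgn (series (telescope u)).
  apply: normed_cvg.
  apply: (@series_le_cvg _ _ (geometric 2 2^-1)) => [n|n|n|].
  - exact: normr_ge0.
  - by rewrite /geometric /= mulr_ge0// exprn_ge0.
  - change (`|u n.+1 - u n| <= 2 * 2^-1 ^+ n).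
    (* Consecutive convergents share the first [n] digits; their tails are [(c n)^-1] and 0. *)
    rewrite /u mkseqS cf_rcons addr0 -[X in _ ^+ X](size_mkseq c n).
    apply: cf_dist_le_pow; first exact: posw_mkseq.
    + by rewrite invr_ge0 ler0n /= invf_le1 ?ler1n ?ltr0n c0.
    + by rewrite lexx ler01.
  - by apply: is_cvg_geometric_series; rewrite ger0_norm; lra.
have -> : (fun n => cf (mkseq c n) 0 : R) = (fun n => u 0 + series (telescope u) n).
  by apply/funext => n; exact: eq_sum_telescope.
by apply: is_cvgD => //; exact: is_cvg_cst.
Qed.

Lemma cfr_itv c : posseq c -> 0 <= cfr c <= 1.
Proof.
move=> c0; have cv := cf_mkseq_cvg c0.
have h n : 0 <= (cf (mkseq c n) 0 : R) <= 1.
  by apply: cf_itv; [exact: posw_mkseq|rewrite lexx ler01].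
by apply/andP; split; [apply: limr_ge|apply: limr_le] => //;
  near=> n; have /andP[] := h n.
Unshelve. all: by end_near. Qed.

Lemma cfr_rec c : posseq c -> cfr c = ((c 0)%:R + cfr (shiftn 1 c))^-1.
Proof.
move=> c0; have c1 := @posseq_shiftn 1 _ c0.
have a0 : 0 < (c 0)%:R :> R by rewrite ltr0n.
apply/cvg_lim => //; rewrite -cvg_shiftS.
rewrite (_ : [sequence _]_n =
  (fun n => ((c 0)%:R + cf (mkseq (shiftn 1 c) n) 0)^-1)); last first.
  by apply/funext => n; rewrite -[LHS]/(cf (mkseq c n.+1) 0) mkseq_shiftn1.
apply: cvgV; first by rewrite lt0r_neq0// ltr_wpDr//; case/andP: (cfr_itv c1).
by apply: cvgD; [exact: cvg_cst|exact: cf_mkseq_cvg].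
Qed.

Lemma cfr_shiftn c n : posseq c ->
  cfr (shiftn n c) = ((c n)%:R + cfr (shiftn n.+1 c))^-1.
Proof.
by move=> c0; rewrite cfr_rec ?shiftn1_shiftn ?{1}/shiftn ?addn0//; exact: posseq_shiftn.
Qed.

Lemma cfr_gt0 c : posseq c -> 0 < cfr c.
Proof.
move=> c0; have /andP[h _] := cfr_itv (@posseq_shiftn 1 _ c0).
by rewrite cfr_rec// invr_gt0 ltr_wpDr// ltr0n.
Qed.

Lemma cfr_lt1 c : posseq c -> cfr c < 1.
Proof.
move=> c0; have h := cfr_gt0 (@posseq_shiftn 1 _ c0).
have a1 : 1 <= (c 0)%:R :> R by rewrite ler1n.
by rewrite cfr_rec// invf_lt1; lra.
Qed.

Lemma cfr_mkseq c n : posseq c -> cfr c = cf (mkseq c n) (cfr (shiftn n c)).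
Proof.
move=> c0; elim: n => [//|n ->].
by rewrite mkseqS cf_rcons -cfr_shiftn.
Qed.

(** Both numbers lie in the same cylinder of every rank, and the cylinders shrink geometrically. *)
Lemma cfr_unique c x : posseq c ->
  (forall n, exists2 t, 0 <= t <= 1 & x = cf (mkseq c n) t) -> x = cfr c.
Proof.
move=> c0 hx; apply/eqP; rewrite -subr_eq0 -normr_le0 leNgt; apply/negP.
move=> /geometric2_small[n]; apply/negP; rewrite -leNgt.
have [t ht ->] := hx n; rewrite (cfr_mkseq n c0) -[X in _ ^+ X](size_mkseq c n).
by apply: cf_dist_le_pow => //; [exact: posw_mkseq|exact/cfr_itv/posseq_shiftn].
Qed.

Lemma gauss_map_cfr c : posseq c -> gauss_map (cfr c : R^o) = cfr (shiftn 1 c).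
Proof.
move=> c0; rewrite /gauss_map gt_eqF ?cfr_gt0// cfr_rec// invrK.
have c1 := @posseq_shiftn 1 _ c0.
rewrite (_ : Num.floor _ = Posz (c 0)).
  by rewrite addrAC subrr add0r.
apply: floor_def; rewrite intrD -pmulrn lerDl (ltW (cfr_gt0 c1)) /=.
by rewrite ltrD2l cfr_lt1.
Qed.

Lemma iter_gauss_map_cfr c n : posseq c ->
  iter n gauss_map (cfr c : R^o) = cfr (shiftn n c).
Proof.
move=> c0; elim: n => //= n ->.
by rewrite gauss_map_cfr ?shiftn1_shiftn//; exact: posseq_shiftn.
Qed.

(* The lower bound comes from the next digit of the second point. *)
Lemma cfr_first_digit_gap c c' : posseq c -> posseq c' ->
  (c 0 < c' 0)%N ->
  ((c' 0).+1%:R ^+ 2 * (c' 1).+1%:R)^-1 <= `|cfr c - cfr c' : R|.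
Proof.
move=> c0 c0' lt.
have hc : (shiftn 1 c' 0 = c' 1) by [].
have [p p'] := (@posseq_shiftn 1 _ c0, @posseq_shiftn 1 _ c0').
rewrite (cfr_rec c0) (cfr_rec c0').
set r := cfr (shiftn 1 c); set r' := cfr (shiftn 1 c').
have r1 : r < 1 := cfr_lt1 p; have r0 : 0 < r := cfr_gt0 p.
have r1' : r' < 1 := cfr_lt1 p'; have r0' : 0 < r' := cfr_gt0 p'.
have hr' : ((c' 1).+1%:R)^-1 <= r'.
  rewrite /r' (cfr_rec p') hc.
  have a0 : 0 < (c' 1)%:R :> R by rewrite ltr0n.
  have := cfr_lt1 (@posseq_shiftn 1 _ p'); have := cfr_gt0 (@posseq_shiftn 1 _ p').
  set r'' := cfr _ => h1 h2.
  rewrite lef_pV2 ?posrE; [|by rewrite ltr0n|lra].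
  by rewrite -natr1; lra.
have ha : 1 <= (c 0)%:R :> R by rewrite ler1n.
have hb : (c 0)%:R + 1 <= (c' 0)%:R :> R by rewrite natr1 ler_nat.
rewrite -(natr1 (c' 0)).
set a : R := (c 0)%:R in ha hb *; set b : R := (c' 0)%:R in hb *.
have -> : (a + r)^-1 - (b + r')^-1 = (b + r' - a - r) / ((a + r) * (b + r')).
  by field; apply/andP; split; rewrite lt0r_neq0//; lra.
rewrite ger0_norm; last by rewrite divr_ge0//; nra.
rewrite invfM mulrC ler_pM ?invr_ge0//.
- by rewrite exprn_ge0//; lra.
(* The numerator is at least [r'], because [b - a >= 1 > r]. *)
- by apply: le_trans hr' _; lra.
rewrite lef_pV2 ?posrE; [|nra..].
by rewrite expr2; nra.
Qed.

End infinite_continued_fraction.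

(** * Inserting blocks of digits *)

Section insertion.
Local Open Scope nat_scope.
Implicit Types (a b : nat -> nat) (n k : nat).

(** The series of [2 / digit_bound n] telescopes to 1/2, so the points violating some bound fill at
    most half of the unit interval, while the bound stays polynomial. *)
Definition digit_bound n := 4 * (n.+1 * n.+2).

Definition bounded_digits a := forall i, 0 < a i <= digit_bound i.

(* Bounds the factor by which the first [k] blocks increase the denominator. *)
Fixpoint block_cost k :=
  if k is k'.+1 then block_cost k' * (4 * (digit_bound k').+1 * 2 ^ k') else 1.

(* Number of blocks inserted among the first [n] digits: the next block is
   inserted as soon as its cost is affordable. *)
Fixpoint nblocks n :=
  if n is n'.+1 then nblocks n' + (block_cost (nblocks n').+1 <= n) else 0.

(* The 2-adic valuation takes every value infinitely often, so that every digit
   is copied infinitely often. *)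
Definition copied k := logn 2 k.+1.

(** The test does not involve [a]: blocks stand at the same places for all sequences, so that images
    can be compared position by position. *)
Definition block a n :=
  if block_cost (nblocks n).+1 <= n.+1
  then a (copied (nblocks n)) :: nseq (nblocks n) 1 else [::].

Fixpoint insertw a n :=
  if n is n'.+1 then insertw a n' ++ a n' :: block a n' else [::].

(** The word [insertw a i.+1] has more than [i] letters, so the default 0 is never returned. *)
Definition insert a i := nth 0 (insertw a i.+1) i.

Lemma bounded_digits_posseq a : bounded_digits a -> posseq a.
Proof. by move=> ha i; case/andP: (ha i). Qed.

Lemma digit_bound_le : {homo digit_bound : m n / m <= n}.
Proof. by move=> m n mn; rewrite /digit_bound; nia. Qed.

Lemma copied_le k : copied k <= k.
Proof. by rewrite /copied -ltnS ltn_logl. Qed.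

Lemma copied_infinitely_often j n : exists2 k, n <= k & copied k = j.
Proof.
(* The number [k.+1] is [2 ^ j] times the odd number [2 n + 1]. *)
exists (2 ^ j * n.*2.+1).-1.
  by have := expn_gt0 2 j; nia.
rewrite /copied prednK ?muln_gt0 ?expn_gt0//.
rewrite lognM ?expn_gt0// pfactorK// [logn 2 n.*2.+1]lognE /=.
by rewrite dvdn2 /= odd_double addn0.
Qed.

(** A block enters only once the new cost is within the bound, which otherwise just grows. Hence all
    blocks together cost at most a linear factor. *)
Lemma block_cost_nblocks n : block_cost (nblocks n) <= n.+1.
Proof.
elim: n => //= n IH; case: (leqP _ n.+1) => [h|_]; last by rewrite addn0 leqW.
by rewrite addn1 leqW.
Qed.

Lemma nblocks_le n : nblocks n <= n.
Proof. by elim: n => //= n IH; rewrite -[n.+1]addn1 leq_add ?leq_b1. Qed.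

Lemma copied_nblocks_le n : copied (nblocks n) <= n.
Proof. exact: leq_trans (copied_le _) (nblocks_le _). Qed.

Lemma nblocks_unbounded k : exists n, k <= nblocks n.
Proof.
elim: k => [|k [m km]]; first by exists 0.
have mono : {homo nblocks : m n / m <= n}.
  by apply: homo_leq => // [x y z|n]; [exact: leq_trans|exact: leq_addr].
pose n := maxn m (block_cost k.+1).
have kn : k <= nblocks n by rewrite (leq_trans km)// mono// leq_maxl.
exists n.+1; rewrite [nblocks _]/=.
move: kn; rewrite leq_eqVlt => /predU1P[<-|]; last exact: ltn_addr.
by rewrite (leq_trans (leq_maxr m _) (leqnSn _)) addn1.
Qed.

(** The counter rises by at most 1 per step, so just before it first exceeds [k] it equals [k], and
    the next block is being inserted. *)
Lemma nblocks_stage k : exists n, nblocks n = k /\ block_cost k.+1 <= n.+1.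
Proof.
have [m km mmin] := ex_minnP (nblocks_unbounded k.+1).
case: m km mmin => // n + mmin; rewrite [nblocks n.+1]/=; set b := (X in _ + nat_of_bool X) => kn.
have nk : nblocks n <= k by rewrite leqNgt; apply/negP => /mmin; rewrite ltnn.
have nk' : nblocks n = k by have := leq_b1 b; lia.
by exists n; split => //; rewrite -nk' -/b; move: kn nk; rewrite nk'; case: b; lia.
Qed.

Lemma insertwS_stage a n : block_cost (nblocks n).+1 <= n.+1 ->
  insertw a n.+1 = insertw a n ++ [:: a n, a (copied (nblocks n)) & nseq (nblocks n) 1].
Proof. by move=> h; rewrite [insertw a n.+1]/= /block h. Qed.

Lemma size_insertw a n : n <= size (insertw a n).
Proof. by elim: n => //= n IH; rewrite size_cat /=; lia. Qed.

Lemma size_insertw_eq a b n : size (insertw a n) = size (insertw b n).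
Proof.
by elim: n => //= n IH; rewrite !size_cat /= IH /block; case: ifP.
Qed.

Lemma insertw_prefix a n p : n <= p -> exists v, insertw a p = insertw a n ++ v.
Proof.
move=> /subnKC <-; elim: (p - n) => [|q [v IH]]; first by exists [::]; rewrite addn0 cats0.
by rewrite addnS /= IH -catA; eexists.
Qed.

Lemma nth_insert a n i : i < size (insertw a n) -> insert a i = nth 0 (insertw a n) i.
Proof.
move=> hi; rewrite /insert; have hi' := size_insertw a i.+1.
case/orP: (leq_total i.+1 n) => /(insertw_prefix a)[v E]; move: hi hi'; rewrite E.
  by move=> _ h; rewrite nth_cat h.
by move=> h _; rewrite nth_cat h.
Qed.

Lemma mkseq_insert a n : mkseq (insert a) (size (insertw a n)) = insertw a n.
Proof.
apply: (@eq_from_nth _ 0); rewrite size_mkseq// => i hi.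
by rewrite nth_mkseq// (nth_insert hi).
Qed.

Lemma insert_digit a n v p : insertw a p = insertw a n ++ v ->
  forall i, i < size v -> insert a (size (insertw a n) + i) = nth 0 v i.
Proof.
move=> E i hi; rewrite (@nth_insert _ p) E ?size_cat ?ltn_add2l//.
by rewrite nth_cat ltnNge leq_addr /= addKn.
Qed.

Lemma insert_fresh a n : insert a (size (insertw a n)) = a n.
Proof. by have := @insert_digit a n _ n.+1 erefl 0 isT; rewrite addn0. Qed.

Lemma insert_copied a n : block_cost (nblocks n).+1 <= n.+1 ->
  insert a (size (insertw a n)).+1 = a (copied (nblocks n)).
Proof.
by move=> /(insertwS_stage a)/insert_digit/(_ 1 isT); rewrite addn1.
Qed.

Lemma mkseq_insert_ones a n : block_cost (nblocks n).+1 <= n.+1 ->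
  mkseq (shiftn (size (insertw a n)).+2 (insert a)) (nblocks n) =
  nseq (nblocks n) 1.
Proof.
move=> /(insertwS_stage a)/insert_digit h.
apply: (@eq_from_nth _ 0); rewrite size_mkseq ?size_nseq// => i hi.
rewrite nth_mkseq// /shiftn -addn2 -addnA add2n h /= ?size_nseq//.
Qed.

Lemma all_insertw (P : pred nat) a n : P 1 -> (forall i, i < n -> P (a i)) ->
  all P (insertw a n).
Proof.
move=> P1; elim: n => //= n IH h; rewrite all_cat IH /=; last first.
  by move=> i ?; apply: h; apply: leqW.
rewrite h// /block; case: ifP => //= _.
by rewrite h ?ltnS ?copied_nblocks_le// all_nseq P1 orbT.
Qed.

Lemma insert_posseq a : posseq a -> posseq (insert a).
Proof.
move=> a0 i; have /all_nthP := @all_insertw (leq 1) a i.+1 isT (fun i _ => a0 i).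
by apply; exact: size_insertw.
Qed.

(** This digit is either a copy of a digit of index at most [n] or, if the block is empty, the fresh
    digit [a n.+1]. It enters the lower bound of [cfr_first_digit_gap]. *)
Lemma insert_after_fresh_le a n : bounded_digits a ->
  insert a (size (insertw a n)).+1 <= digit_bound n.+1.
Proof.
move=> ha; rewrite -addn1.
rewrite (@insert_digit a n (a n :: block a n ++ a n.+1 :: block a n.+1) n.+2).
- rewrite /= /block; case: ifP => _ /=; last by case/andP: (ha n.+1).
  have /andP[_ h] := ha (copied (nblocks n)).
  by rewrite (leq_trans h)// digit_bound_le// leqW// copied_nblocks_le.
- by rewrite /= -catA.
- by rewrite /= size_cat addnS.
Qed.

Lemma eq_insertw a b n : (forall i, i < n -> a i = b i) -> insertw a n = insertw b n.
Proof.
elim: n => //= n IH h; rewrite IH => [|i ?]; last by apply: h; apply: leqW.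
by rewrite h// /block h// ltnS copied_nblocks_le.
Qed.

Lemma cf_den_block {R : realType} (d : nat) k : 0 < d ->
  (cf_den (d :: nseq k 1) 0 <= (d.+1 * 2 ^ k)%:R :> R)%R.
Proof.
move=> d0; have nseq1 m : posw (nseq m 1) by rewrite /posw all_nseq orbT.
have itv m : (0 <= cf (nseq m 1) (0 : R) <= 1)%R.
  by apply: cf_itv => //; rewrite lexx ler01.
have den m : (cf_den (nseq m 1) 0 <= (2 ^ m)%:R :> R)%R.
  elim: m => //= m IH; have /andP[? ?] := itv m.
  rewrite expnS natrM ler_pM//; last by lra.
    by apply: addr_ge0.
  exact/ltW/cf_den_gt0.
have /andP[? ?] := itv k.
rewrite /= natrM -natr1 ler_pM//.
- by apply: addr_ge0 => //.
- exact/ltW/cf_den_gt0.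
- by rewrite lerD2l.
Qed.

(** The suffix [v] carries the induction: the last digit and its block move into it. Removing a
    block [b] costs [4 * cf_den b 0], with one factor 2 from each of two splittings by
    [cf_den_cat_bounds]. *)
Lemma cf_den_insertw {R : realType} a n v : bounded_digits a -> posw v ->
  (cf_den (insertw a n ++ v) 0 <=
   (block_cost (nblocks n))%:R * cf_den (mkseq a n ++ v) 0 :> R)%R.
Proof.
move=> ha; have pa := bounded_digits_posseq ha.
elim: n v => [|n IH] v v0; first by rewrite mul1r.
rewrite mkseqS -cats1 -catA [insertw a n.+1]/= -catA /= /block.
have pw : posw (rcons (mkseq a n) (a n)) by rewrite -mkseqS; exact: posw_mkseq.
case: leqP => h; last first.
  by rewrite addn0 cat0s; apply: IH; rewrite /posw /= pa.
set b := a (copied _) :: _.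
have b0 : posw b by rewrite /posw /b -cat1s all_cat all_nseq orbT andbT all_seq1 pa.
apply: le_trans (IH (a n :: b ++ v) _) _.
  by rewrite /posw -cat1s !all_cat all_seq1 pa -/(posw b) b0.
rewrite addn1 [block_cost _.+1]/= natrM -mulrA ler_wpM2l//.
rewrite -cat_rcons -[X in (_ <= _ * cf_den X _)%R]cat_rcons.
have bv0 : posw (b ++ v) by rewrite /posw all_cat; apply/andP.
have /andP[_ h1] := cf_den_cat_bounds (R := R) pw bv0.
have /andP[_ h2] := cf_den_cat_bounds (R := R) b0 v0.
have /andP[h3 _] := cf_den_cat_bounds (R := R) pw v0.
have h4 : (cf_den b 0 <= ((digit_bound (nblocks n)).+1 * 2 ^ nblocks n)%:R :> R)%R.
  apply: le_trans (cf_den_block _ (pa _)) _.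
  rewrite ler_nat leq_mul2r ltnS; apply/orP; right.
  have /andP[_ h5] := ha (copied (nblocks n)).
  by rewrite (leq_trans h5)// digit_bound_le// copied_le.
rewrite -mulnA natrM.
have q1 := cf_den_ge1 (R := R) pw; have q2 := cf_den_ge1 (R := R) v0.
have q3 := cf_den_ge1 (R := R) b0.
apply: le_trans h1 _.
move: h2 h3 h4 q1 q2 q3; move: (cf_den b 0%R) (cf_den v 0%R) (cf_den (b ++ v) 0%R) => z y u.
move: (cf_den _ _) (cf_den _ _) => q x h2 h3 h4 q1 q2 q3.
apply: (@le_trans _ _ (4 * z * (x * y)))%R; last first.
  by rewrite -!(mulrA 4%R) ler_pM2l// ler_pM//; nra.
by nra.
Qed.

End insertion.

(** * Hoelder continuity of the removal of the blocks *)

Section hoelder_estimate.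
Context {R : realType}.
Implicit Types (a b : nat -> nat) (n : nat) (s : R).

(** The 4 comes from [cf_dist_ge], the square from the linear cost of the blocks in a squared
    denominator, and the cube from [cfr_first_digit_gap]. *)
Definition distortion n : R :=
  4 * n.+1%:R ^+ 2 * (digit_bound n.+1).+1%:R ^+ 3.

Lemma distortion_gt0 n : 0 < distortion n.
Proof. by rewrite /distortion !mulr_gt0// exprn_gt0. Qed.

Lemma first_difference a b : a <> b ->
  exists n, (forall i, (i < n)%N -> a i = b i) /\ a n != b n.
Proof.
move=> ab; have /ex_minnP[n hn nmin] : exists n, a n != b n.
  apply: contrapT => h; apply: ab; apply/funext => i.
  by apply/eqP; apply: contrapT => /negP hi; apply: h; exists i.
exists n; split=> // i; apply: contraPP => /eqP /nmin.
by rewrite ltnNge => ->.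
Qed.

(** The two images share the word [insertw a n] and continue with the differing fresh digits [a n]
    and [b n]. The gap of the tails is then contracted by the common word. *)
Lemma insert_digits_apart a b n : bounded_digits a -> bounded_digits b ->
  (forall i, (i < n)%N -> a i = b i) -> a n != b n ->
  (distortion n * cf_den (mkseq a n) 0 ^+ 2)^-1 <=
  `|cfr (insert a) - cfr (insert b) : R|.
Proof.
wlog ab : a b / (a n < b n)%N.
  move=> H ha hb eab nab.
  have [lt|] := ltnP (a n) (b n); first exact: H.
  rewrite leq_eqVlt eq_sym (negbTE nab) /= => lt; rewrite distrC.
  have -> : mkseq a n = mkseq b n.
    by apply/eq_in_map => i; rewrite mem_iota => /andP[_]; exact: eab.
  by apply: H => // [i /eab//|]; rewrite eq_sym.
move=> ha hb eab _.
have pa := insert_posseq (bounded_digits_posseq ha).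
have pb := insert_posseq (bounded_digits_posseq hb).
set N := size (insertw a n).
have NE : N = size (insertw b n) by rewrite /N (eq_insertw eab).
rewrite (cfr_mkseq N pa) (cfr_mkseq N pb).
have -> : mkseq (insert a) N = insertw a n by rewrite mkseq_insert.
have -> : mkseq (insert b) N = insertw a n.
  by rewrite NE mkseq_insert (eq_insertw eab).
have w0 : posw (insertw a n) by rewrite -mkseq_insert posw_mkseq.
have ps c : posseq c -> 0 <= (cfr (shiftn N c) : R) <= 1.
  by move=> ?; exact/cfr_itv/posseq_shiftn.
apply: le_trans (cf_dist_ge w0 (ps _ pa) (ps _ pb)).
have -> : (distortion n * cf_den (mkseq a n) 0 ^+ 2)^-1 =
   ((digit_bound n.+1).+1%:R ^+ 3)^-1 /
   (4 * (n.+1%:R * cf_den (mkseq a n) 0) ^+ 2) :> R.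
  by rewrite -invfM; congr (_^-1); rewrite /distortion; ring.
have q1 := cf_den_ge1 (R := R) (posw_mkseq n (bounded_digits_posseq ha)).
have Q1 := cf_den_ge1 (R := R) w0.
have Qle : cf_den (insertw a n) 0 <= n.+1%:R * cf_den (mkseq a n) 0 :> R.
  have := @cf_den_insertw R a n [::] ha isT; rewrite !cats0 => h.
  apply: le_trans h _; rewrite ler_wpM2r//; first by lra.
  by rewrite ler_nat block_cost_nblocks.
apply: ler_pM.
- by rewrite invr_ge0 exprn_ge0.
- rewrite invr_ge0 mulr_ge0// exprn_ge0//; nra.
- have fa : shiftn N (insert a) 0 = a n by rewrite /shiftn addn0 insert_fresh.
  have fb : shiftn N (insert b) 0 = b n by rewrite /shiftn addn0 NE insert_fresh.
  have fb1 : (shiftn N (insert b) 1 <= digit_bound n.+1)%N.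
    by rewrite /shiftn addn1 NE insert_after_fresh_le.
  have lt : (shiftn N (insert a) 0 < shiftn N (insert b) 0)%N by rewrite fa fb.
  have := cfr_first_digit_gap (R := R)
    (posseq_shiftn N pa) (posseq_shiftn N pb) lt.
  apply: le_trans; rewrite fb lef_pV2 ?posrE ?mulr_gt0 ?exprn_gt0//.
  rewrite [leRHS]exprSr ler_pM ?exprn_ge0// ?ler_nat//.
  rewrite lerXn2r ?nnegrE// ler_nat ltnS.
  have /andP[_ h] := hb n; apply: leq_trans h _; exact: digit_bound_le.
- rewrite lef_pV2 ?posrE ?mulr_gt0 ?exprn_gt0//; [|nra..].
  by rewrite ler_pM2l// lerXn2r ?nnegrE//; nra.
Qed.

(** The tangent bound ln(1 + x) <= x at [x = e * n.+1%:R - 1]; the slope [e] may be taken as small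
    as desired. *)
Lemma ln_natS_le (e : R) n : 0 < e -> ln n.+1%:R <= e * n.+1%:R - ln e.
Proof.
move=> e0; have h0 : 0 < e * n.+1%:R by rewrite mulr_gt0.
have : ln (1 + (e * n.+1%:R - 1)) <= e * n.+1%:R - 1 by apply: le_ln1Dx; lra.
by rewrite addrC subrK lnM ?posrE//; lra.
Qed.

(* The distortion is polynomial in [n], whereas denominators of continued
   fractions grow exponentially. *)
Lemma distortion_subexponential s : 0 <= s < 1 ->
  exists c : R, forall n, s * ln (distortion n) <= c + (1 - s) * (n%:R * ln 2).
Proof.
move=> /andP[s0 s1]; have ln2 : 0 < ln 2 :> R by rewrite ln_gt0// ltr1n.
(* The distortion is at most a constant times [n.+1%:R ^+ 8], so eight times the slope has to be
   [(1 - s) * ln 2]. *)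
pose e : R := (1 - s) * ln 2 / 8.
have e0 : 0 < e by rewrite divr_gt0// mulr_gt0// subr_gt0.
pose K : R := 4 * 25 ^+ 3.
exists (ln K - 8 * ln e + 8 * e) => n.
have n1 : 1 <= n.+1%:R :> R by rewrite ler1n.
have DK : distortion n <= K * n.+1%:R ^+ 8.
  have hb : (digit_bound n.+1).+1%:R <= 25 * n.+1%:R ^+ 2 :> R.
    rewrite -natrX -natrM ler_nat /digit_bound; nia.
  rewrite /distortion /K (_ : 4 * 25 ^+ 3 * n.+1%:R ^+ 8 =
    4 * n.+1%:R ^+ 2 * (25 * n.+1%:R ^+ 2) ^+ 3 :> R); last by ring.
  by rewrite ler_pM2l ?mulr_gt0 ?exprn_gt0// lerXn2r// nnegrE// mulr_ge0// exprn_ge0.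
have D1 : 1 <= distortion n.
  rewrite /distortion -!natrX -!natrM ler1n !muln_gt0 ?expn_gt0 //.
have K0 : 0 < K by rewrite mulr_gt0// exprn_gt0.
have h1 : ln (distortion n) <= ln K + 8 * ln n.+1%:R.
  rewrite (_ : 8 * ln _ = ln (n.+1%:R ^+ 8)); last first.
    by rewrite lnXn// mulr_natl.
  by rewrite -lnM ?posrE ?exprn_gt0// ler_ln// posrE ?distortion_gt0// mulr_gt0 ?exprn_gt0.
have h2 : 0 <= ln (distortion n) by rewrite ln_ge0.
have h3 := @ln_natS_le e n e0.
have h4 : 8 * (e * n.+1%:R) = (1 - s) * (n%:R * ln 2) + 8 * e.
  by rewrite /e -natr1; field.
apply: (@le_trans _ _ (ln (distortion n))); first by nra.
by apply: le_trans h1 _; lra.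
Qed.

(** Let q be the denominator of the common digits and D the distortion. The points are at most q^-2
    apart and their images at least (D q^2)^-1, so it suffices that s ln D <= ln C + (1 - s) ln q^2,
    which exponential growth of q provides. *)
Lemma insert_hoelder s : 0 <= s < 1 -> exists2 C : R, 0 < C &
  forall a b, bounded_digits a -> bounded_digits b ->
  `|cfr a - cfr b : R| <= C * `|cfr (insert a) - cfr (insert b) : R| `^ s.
Proof.
move=> hs; have [c hc] := distortion_subexponential hs.
have /andP[s0 s1] := hs.
have ln2 : 0 < ln 2 :> R by rewrite ln_gt0// ltr1n.
(* The summand [(1 - s) * ln 2] is there because q^2 is only known to be at least 2^(n-1). *)
exists (expR (c + (1 - s) * ln 2)) => [|a b ha hb]; first exact: expR_gt0.
have [->|/first_difference[n [eab nab]]] := pselect (a = b).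
  by rewrite !subrr normr0 mulr_ge0// ?expR_ge0 ?powR_ge0.
have := insert_digits_apart ha hb eab nab.
set u := `|cfr (insert a) - _|.
have pw := posw_mkseq n (bounded_digits_posseq ha).
set q := cf_den (mkseq a n) 0 => hu.
have q1 : 1 <= q := cf_den_ge1 pw.
have D0 := distortion_gt0 n.
have qq0 : 0 < q ^+ 2 by rewrite exprn_gt0//; lra.
have Dq0 : 0 < distortion n * q ^+ 2 by rewrite mulr_gt0.
have xy : `|cfr a - cfr b : R| <= (q ^+ 2)^-1.
  have eab' : mkseq b n = mkseq a n.
    by apply/esym/eq_in_map => i; rewrite mem_iota => /andP[_]; exact: eab.
  have pa := bounded_digits_posseq ha; have pb := bounded_digits_posseq hb.
  rewrite (cfr_mkseq n pa) (cfr_mkseq n pb) eab'.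
  have ia := cfr_itv (R := R) (posseq_shiftn n pa).
  have ib := cfr_itv (R := R) (posseq_shiftn n pb).
  apply: le_trans (cf_dist_le pw ia ib) _.
  rewrite ler_piMl ?invr_ge0 ?(ltW qq0)// ler_norml; lra.
apply: le_trans xy _.
apply: (@le_trans _ _ (expR (c + (1 - s) * ln 2) * (distortion n * q ^+ 2)^-1 `^ s)); last first.
  by rewrite ler_pM2l ?expR_gt0// ge0_ler_powR// ?nnegrE ?invr_ge0 ?(ltW Dq0)// normr_ge0.
rewrite /powR invr_eq0 gt_eqF// -expRD -[leLHS]lnK ?posrE ?invr_gt0// ler_expR.
rewrite !lnV ?posrE// lnM ?posrE//.
have lq : (n%:R - 1) * ln 2 <= ln (q ^+ 2).
  have := cf_den_sqr_ge (R := R) pw; rewrite size_mkseq -/q => h.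
  have : ln (2 ^+ n) <= ln (2 * q ^+ 2).
    by rewrite ler_ln// posrE ?exprn_gt0// mulr_gt0.
  by rewrite lnXn// lnM ?posrE// -mulr_natl; lra.
have := hc n; nra.
Qed.

Lemma insert_inj a b : bounded_digits a -> bounded_digits b -> a <> b ->
  cfr (insert a) != cfr (insert b) :> R.
Proof.
move=> ha hb /first_difference[n [eab nab]].
rewrite -subr_eq0 -normr_gt0; apply: lt_le_trans (insert_digits_apart ha hb eab nab).
have q1 := cf_den_ge1 (R := R) (posw_mkseq n (bounded_digits_posseq ha)).
by rewrite invr_gt0 mulr_gt0 ?distortion_gt0// exprn_gt0//; lra.
Qed.

End hoelder_estimate.

(** * Lebesgue measure of the points with bounded digits *)

Section lebesgue_covering.
Context {R : realType}.
Implicit Types (a : nat -> nat) (n m : nat) (w : seq nat) (X : set R).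

(** Sets of a Hausdorff cover need not be measurable; the hull replaces such a set by an interval
    without enlarging the diameter. *)
Definition hull X : set R := `[inf X, sup X].

Lemma measurable_hull X : measurable (hull X).
Proof. exact: measurable_itv. Qed.

Lemma sub_hull X : X `<=` `[0, 1] -> X `<=` hull X.
Proof.
move=> X01 x Xx; rewrite /hull /= in_itv /=; apply/andP; split.
  by apply: ge_inf => //; exists 0 => y /X01; rewrite /= in_itv => /andP[].
by apply: ub_le_sup => //; exists 1 => y /X01; rewrite /= in_itv => /andP[].
Qed.

Lemma lebesgue_measure_hull X (d : \bar R) : (0 <= d)%E ->
  (forall x y, X x -> X y -> (`|x - y|%:E <= d)%E) ->
  (lebesgue_measure (hull X) <= d)%E.
Proof.
move=> d0 hX; rewrite lebesgue_measure_itv /=; case: ifP => // lt.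
case: d d0 hX => [d d0 hX|_ _|//]; last exact: leey.
rewrite -EFinB lee_fin lerBlDr.
have [X0|/nonemptyPn X0] := pselect (X !=set0); last first.
  by move: lt; rewrite X0 sup0 inf0 ltxx.
apply: ge_sup => // x Xx; rewrite -lerBlDl.
apply: lb_le_inf => // y Xy.
have := hX _ _ Xx Xy; rewrite lee_fin ler_norml; lra.
Qed.

Fixpoint bounded_words n : seq (seq nat) :=
  if n is n'.+1 then
    [seq rcons w d | w <- bounded_words n', d <- index_iota 1 (digit_bound n').+1]
  else [:: [::]].

Lemma bounded_wordsS n : bounded_words n.+1 =
  [seq rcons w d | w <- bounded_words n, d <- index_iota 1 (digit_bound n).+1].
Proof. by []. Qed.

Lemma bounded_words_posw n w : w \in bounded_words n -> posw w.
Proof.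
elim: n w => [|n IH] w; first by rewrite inE => /eqP ->.
rewrite bounded_wordsS => /allpairsPdep[v [d [/IH v0 + ->]]].
by rewrite mem_index_iota /posw all_rcons => /andP[-> _].
Qed.

(** For positive digits [cf_sub] makes this the distance between the ends [cf w 0] and [cf w 1] of
    the cylinder of [w]. *)
Definition cylinder_length w : R := (cf_den w 0 * cf_den w 1)^-1.

(** Neighbouring cylinders share an end point, so the sum telescopes to the explicit difference used
    in the proof. *)
Lemma sum_cylinder_length w m : posw w ->
  \sum_(1 <= d < m.+1) cylinder_length (rcons w d) <= cylinder_length w.
Proof.
move=> w0; have [q1 qp _] := cf_den1 (R := R) w0.
suff -> : \sum_(1 <= d < m.+1) cylinder_length (rcons w d) =
    (cf_den w 0)^-1 * ((cf_den w 1)^-1 - (m%:R * cf_den w 0 + cf_den w 1)^-1).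
  rewrite /cylinder_length invfM ler_wpM2l ?invr_ge0//; first by lra.
  rewrite gerBl invr_ge0 addr_ge0 ?mulr_ge0//; lra.
elim: m => [|m IH]; first by rewrite big_geq// mul0r add0r subrr mulr0.
rewrite big_nat_recr //= IH /cylinder_length !cf_den_rcons//.
have m0 : 0 <= m%:R :> R by [].
rewrite -natr1; move: (m%:R : R) (cf_den w 0) (cf_den w 1) m0 q1 qp => z q p m0 q1 qp.
by field; rewrite ?lt0r_neq0//; nra.
Qed.

Lemma sum_bounded_words n :
  \sum_(w <- bounded_words n) cylinder_length w <= 1.
Proof.
elim: n => [|n IH]; first by rewrite /= big_seq1 /cylinder_length /= mulr1 invr1.
rewrite bounded_wordsS big_allpairs_dep; apply: le_trans IH.
rewrite big_seq [leRHS]big_seq; apply: ler_sum => w /bounded_words_posw w0.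
exact: sum_cylinder_length.
Qed.

(** A tail above the cutoff has its next digit within the bound. The tail 0, at which an expansion
    stops, lies below it. *)
Definition cutoff n : R := (digit_bound n).+1%:R^-1.

Lemma cutoff_itv n : 0 < cutoff n <= 1.
Proof. by rewrite invr_gt0 ltr0n /= invf_le1 ?ler1n ?ltr0n. Qed.

(* Points whose first [n] digits obey the bounds and whose next digit does not. *)
Definition bad_set n : set R :=
  \big[setU/set0]_(w <- bounded_words n) hull [set cf w t | t in `[0, cutoff n]].

Lemma measurable_bad_set n : measurable (bad_set n).
Proof. by apply: bigsetU_measurable => w _; exact: measurable_hull. Qed.

Lemma lebesgue_measure_bigsetU (I : Type) (s : seq I) (F : I -> set R) :
  (forall i, measurable (F i)) ->
  (lebesgue_measure (\big[setU/set0]_(i <- s) F i) <=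
   \sum_(i <- s) lebesgue_measure (F i))%E.
Proof.
move=> mF; elim: s => [|i s IH]; first by rewrite !big_nil measure0.
rewrite !big_cons.
have mU : measurable (\big[setU/set0]_(i <- s) F i).
  by apply: bigsetU_measurable => ? _; exact: mF.
have := measureU2 (@lebesgue_measure R) (mF i) mU.
by move/le_trans; apply; exact: leeD2l.
Qed.

(** In each cylinder the bad part has length at most [cutoff n / cf_den w 0 ^+ 2], which is at most
    [2 * cutoff n] times the cylinder length; these lengths sum to at most 1. *)
Lemma lebesgue_measure_bad_set n :
  (lebesgue_measure (bad_set n) <= (2 * cutoff n)%:E)%E.
Proof.
have /andP[c0 c1] := cutoff_itv n.
apply: le_trans (lebesgue_measure_bigsetU _ _) _.
  by move=> w; exact: measurable_hull.
apply: (@le_trans _ _ (\sum_(w <- bounded_words n) (2 * cutoff n * cylinder_length w)%:E)%E).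
  rewrite big_seq [leRHS]big_seq; apply: lee_sum => w /bounded_words_posw w0.
  have [q1 qp pq] := cf_den1 (R := R) w0.
  have len : cutoff n / cf_den w 0 ^+ 2 <= 2 * cutoff n * cylinder_length w.
    rewrite /cylinder_length [2 * cutoff n]mulrC -mulrA ler_pM2l//.
    rewrite -[X in _ <= X * _]invrK -invfM lef_pV2 ?posrE; [nra|nra|].
    by rewrite mulr_gt0 ?invr_gt0// mulr_gt0; lra.
  apply: lebesgue_measure_hull.
    by rewrite lee_fin; apply: le_trans len; rewrite divr_ge0 ?ltW// exprn_gt0//; lra.
  move=> _ _ [t + <-] [t' + <-]; rewrite /= !in_itv /= => /andP[t0 tc] /andP[t'0 t'c].
  rewrite lee_fin; apply: le_trans len.
  have ht : 0 <= t <= 1 by rewrite t0 (le_trans tc).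
  have ht' : 0 <= t' <= 1 by rewrite t'0 (le_trans t'c).
  apply: le_trans (cf_dist_le w0 ht ht') _.
  rewrite ler_wpM2r ?invr_ge0 ?exprn_ge0//; first by lra.
  by rewrite ler_norml; lra.
rewrite sumEFin lee_fin -mulr_sumr ler_piMr//; last exact: sum_bounded_words.
by rewrite mulr_ge0// ltW.
Qed.

Definition gauss_digit (x : R) n : nat :=
  `|Num.floor (iter n (gauss_map : R^o -> R^o) x)^-1|%N.

Lemma iter_gauss_map_itv (x : R) n : 0 <= x < 1 ->
  0 <= (iter n (gauss_map : R^o -> R^o) x : R) < 1.
Proof.
move=> hx; elim: n => //= n IH.
have /= := @gauss_map_fun R (iter n (gauss_map : R^o -> R^o) x).
by rewrite !in_itv /=; apply.
Qed.

Lemma gauss_digitP (x : R) n : 0 <= x < 1 ->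
  0 < (iter n (gauss_map : R^o -> R^o) x : R) ->
  (iter n (gauss_map : R^o -> R^o) x : R) =
   ((gauss_digit x n)%:R + iter n.+1 (gauss_map : R^o -> R^o) x)^-1 /\
  (0 < gauss_digit x n)%N.
Proof.
move=> hx; have /andP[_ ht1] := iter_gauss_map_itv n hx.
rewrite iterS /gauss_digit; set t : R := iter n _ x => t0.
have f1 : (1 <= Num.floor t^-1)%R.
  by rewrite floor_ge_int /= invf_ge1// ltW.
have e : (`|Num.floor t^-1|%N)%:R = (Num.floor t^-1)%:~R :> R.
  by rewrite -[in RHS](gez0_abs (le_trans ler01 f1)) -pmulrn.
split; last by rewrite absz_gt0 gt_eqF// (lt_le_trans ltr01).
by rewrite e /gauss_map gt_eqF//= addrC subrK invrK.
Qed.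

Lemma gauss_digit_words (x : R) n : 0 <= x < 1 ->
  (forall i, (i < n)%N -> cutoff i < (iter i (gauss_map : R^o -> R^o) x : R)) ->
  [/\ forall i, (i < n)%N -> (0 < gauss_digit x i <= digit_bound i)%N,
      mkseq (gauss_digit x) n \in bounded_words n &
      x = cf (mkseq (gauss_digit x) n) (iter n (gauss_map : R^o -> R^o) x)].
Proof.
move=> hx; elim: n => [|n IH] hn; first by split=> //; rewrite inE.
have [|IH1 IH2 IH3] := IH; first by move=> i ?; apply: hn; exact: leqW.
have hc := hn n (ltnSn n); have /andP[c0 _] := cutoff_itv n.
have [e d0] := gauss_digitP hx (lt_trans c0 hc).
have db : (0 < gauss_digit x n <= digit_bound n)%N.
  rewrite d0 /= -ltnS -(ltr_nat R).
  have /andP[t0 _] := iter_gauss_map_itv n.+1 hx.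
  move: hc; rewrite e /cutoff ltf_pV2 ?posrE ?ltr0n//; first by lra.
  by rewrite ltr_wpDr// ltr0n.
split.
- by move=> i; rewrite ltnS leq_eqVlt => /predU1P[->//|]; exact: IH1.
- rewrite mkseqS bounded_wordsS; apply: allpairs_f_dep => //.
  by rewrite mem_index_iota ltnS.
- by rewrite mkseqS cf_rcons -e.
Qed.

(** Either every tail exceeds its cutoff, and [x] lies in all cylinders of its digit sequence, or
    the first tail that fails puts [x] into a bad set. *)
Lemma bounded_or_bad (x : R) : 0 <= x < 1 ->
  (exists2 a, bounded_digits a & x = cfr a) \/ exists n, bad_set n x.
Proof.
move=> hx.
have [all_lt|/existsNP ex] :=
    pselect (forall i, cutoff i < (iter i (gauss_map : R^o -> R^o) x : R)).
  left; exists (gauss_digit x).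
    by move=> i; have [h _ _] := @gauss_digit_words x i.+1 hx (fun j _ => all_lt j); exact: h.
  apply: cfr_unique => [i|n].
    by have [h _ _] := @gauss_digit_words x i.+1 hx (fun j _ => all_lt j);
       have /andP[] := h i (ltnSn i).
  have [_ _ e] := @gauss_digit_words x n hx (fun j _ => all_lt j).
  exists (iter n (gauss_map : R^o -> R^o) x) => //.
  by have /andP[-> /ltW ->] := iter_gauss_map_itv n hx.
right.
have {}ex : exists i, ~~ (cutoff i < (iter i (gauss_map : R^o -> R^o) x : R)).
  by case: ex => i hi; exists i; apply/negP.
have [n hn nmin] := ex_minnP ex; exists n.
have [i hi|_ h2 h3] := @gauss_digit_words x n hx.
  by apply: contraTT hi => /nmin; rewrite -leqNgt.
rewrite /bad_set -bigcup_seq; exists (mkseq (gauss_digit x) n) => //.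
apply: sub_hull; last first.
  exists (iter n (gauss_map : R^o -> R^o) x) => //=.
  by rewrite in_itv /= [X in _ && X]leNgt hn andbT; case/andP: (iter_gauss_map_itv n hx).
move=> _ [t /= + <-]; rewrite !in_itv /= => /andP[t0 tc].
apply: cf_itv; first exact: bounded_words_posw h2.
by rewrite t0 (le_trans tc)//; case/andP: (cutoff_itv n).
Qed.

Lemma sum_bad_sets :
  (\sum_(0 <= n <oo) (2 * cutoff n)%:E <= (2^-1)%:E :> \bar R)%E.
Proof.
have c0 n : 0 < cutoff n by case/andP: (cutoff_itv n).
have ps N : \sum_(0 <= n < N) (2 * cutoff n) <= 2^-1 * (1 - N.+1%:R^-1).
  elim: N => [|N IH]; first by rewrite big_geq// invr1 subrr mulr0.
  rewrite big_nat_recr//=; apply: le_trans (lerD IH (lexx _)) _.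
  have n0 : 0 < N.+1%:R :> R by rewrite ltr0n.
  have h : cutoff N <= (4 * (N.+1%:R * (N.+1%:R + 1)))^-1.
    rewrite lef_pV2 ?posrE ?ltr0n// ?mulr_gt0// ?addr_gt0//.
    by rewrite natr1 -!natrM ler_nat /digit_bound leqnSn.
  apply: le_trans (lerD (lexx _) (ler_wpM2l _ h)) _ => //.
  rewrite -(natr1 N.+1); move: (N.+1%:R : R) n0 => z z0.
  rewrite le_eqVlt; apply/orP; left; apply/eqP; field.
  by apply/andP; split; rewrite lt0r_neq0//; lra.
apply: lime_le.
  by apply: is_cvg_nneseries => n _ _; rewrite lee_fin mulr_ge0// ltW.
near=> N; rewrite sumEFin lee_fin; apply: le_trans (ps N) _.
by rewrite ler_piMr// gerBl invr_ge0.
Unshelve. all: by end_near. Qed.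

(** The hulls of the [X i] and the bad sets cover the unit interval, and the bad sets account for at
    most 1/2 of its length. *)
Lemma bounded_digits_cover (X : (set R)^nat) (d : nat -> \bar R) :
  (forall i, X i `<=` `[0, 1]) -> (forall i, (0 <= d i)%E) ->
  (forall i x y, X i x -> X i y -> (`|x - y|%:E <= d i)%E) ->
  (forall a, bounded_digits a -> exists i, X i (cfr a)) ->
  ((2^-1)%:E <= \sum_(0 <= i <oo) d i)%E.
Proof.
move=> X01 d0 Xd cover.
have c0 n : 0 <= 2 * cutoff n.
  by rewrite mulr_ge0// ltW//; case/andP: (cutoff_itv n).
have h : (lebesgue_measure (`[0%R, 1%R[%classic : set R) <=
    \sum_(0 <= i <oo) (d i + (2 * cutoff i)%:E))%E.
  apply: (@le_trans _ _ (\sum_(0 <= i <oo)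
      lebesgue_measure (hull (X i) `|` bad_set i))%E).
    apply: measure_sigma_subadditive => [n||x /=].
    - by apply: measurableU; [exact: measurable_hull|exact: measurable_bad_set].
    - exact: measurable_itv.
    - rewrite in_itv /= => /bounded_or_bad[[a ha ->]|[n hn]].
        have [i Xi] := cover a ha; exists i => //; left.
        by apply: sub_hull => //; exact: X01.
      by exists n => //; right.
  apply: lee_nneseries => // i _.
  have := measureU2 (@lebesgue_measure R) (measurable_hull (X i)) (measurable_bad_set i).
  move/le_trans; apply.
  apply: leeD; last exact: lebesgue_measure_bad_set.
  by apply: lebesgue_measure_hull => // x y; exact: Xd.
rewrite nneseriesD in h; last 2 first.
- by move=> i _ _; exact: d0.
- by move=> i _ _; rewrite lee_fin.
have := le_trans h (leeD2l _ sum_bad_sets).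
rewrite lebesgue_measure_itv /= lte_fin ltr01 -EFinB subr0.
case: (\sum_(0 <= i <oo) d i)%E => [r| |].
- by rewrite -EFinD !lee_fin; lra.
- by move=> _; exact: leey.
- by rewrite addNye leeNy_eq.
Qed.

End lebesgue_covering.

(** * Scrambled pairs *)

Section limsup_liminf.
Context {R : realType}.
Local Open Scope ereal_scope.
Implicit Types (u : (\bar R)^nat).

Lemma limn_esup_gt0 u (e : R) : (0 < e)%R ->
  (forall n, exists2 p, (n <= p)%N & e%:E <= u p) -> 0 < limn_esup u.
Proof.
move=> e0 hu; apply: (@lt_le_trans _ _ e%:E); first by rewrite lte_fin.
rewrite limn_esup_lim; apply: lime_ge; first exact: is_cvg_esups.
near=> n; have [p np ep] := hu n; apply: le_trans ep _.
by apply: ereal_sup_ubound; exists p.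
Unshelve. all: by end_near. Qed.

Lemma limn_einf_eq0 u : (forall n, 0 <= u n) ->
  (forall (e : R) n, (0 < e)%R -> exists2 p, (n <= p)%N & u p <= e%:E) ->
  limn_einf u = 0.
Proof.
move=> u0 hu; apply/eqP; rewrite eq_le limn_einf_lim; apply/andP; split.
  apply/lee_addgt0Pr => e e0; rewrite add0e.
  apply: lime_le; first exact: is_cvg_einfs.
  near=> n; have [p np ep] := hu e n e0; apply: le_trans ep.
  by apply: ereal_inf_lbound; exists p.
apply: lime_ge; first exact: is_cvg_einfs.
by near=> n; apply: le_ereal_inf_tmp => _ [p _ <-].
Unshelve. all: by end_near. Qed.

End limsup_liminf.

Section scrambled_insertions.
Context {R : realType}.
Implicit Types (a b : nat -> nat) (n k : nat).

(** Distinct digits differ by at least 1, so tails within 1/2 of each other leave a numerator of at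
    least 1/2. *)
Lemma inv_natD_gap (x y : nat) (r r' : R) : (0 < x)%N -> (0 < y)%N -> x != y ->
  0 <= r <= 1 -> 0 <= r' <= 1 -> `|r - r'| <= 2^-1 ->
  (2 * (x.+1%:R * y.+1%:R))^-1 <= `|(x%:R + r)^-1 - (y%:R + r')^-1|.
Proof.
wlog xy : x y r r' / (x < y)%N.
  move=> H x0 y0 nxy hr hr' hrr.
  have [lt|] := ltnP x y; first exact: H.
  rewrite leq_eqVlt eq_sym (negbTE nxy) /= => lt.
  by rewrite distrC [x.+1%:R * _]mulrC; apply: H; rewrite // 1?eq_sym// distrC.
move=> x0 y0 _ /andP[r0 r1] /andP[r0' r1'] hrr.
have x1 : 1 <= x%:R :> R by rewrite ler1n.
have xy1 : x%:R + 1 <= y%:R :> R by rewrite natr1 ler_nat.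
rewrite -(natr1 x) -(natr1 y); move: (x%:R : R) (y%:R : R) x1 xy1 => u v u1 uv.
have -> : (u + r)^-1 - (v + r')^-1 = (v - u + (r' - r)) / ((u + r) * (v + r')).
  by field; apply/andP; split; rewrite lt0r_neq0//; lra.
have h : 2^-1 <= v - u + (r' - r) by move: hrr; rewrite ler_norml; lra.
rewrite ger0_norm; last by rewrite divr_ge0//; nra.
rewrite invfM ler_pM ?invr_ge0//; first by nra.
by rewrite lef_pV2 ?posrE; nra.
Qed.

(** The offset 2 skips the fresh digit and the copied one; both sequences then begin with
    [nblocks n] ones. *)
Lemma insert_common_block a b n : bounded_digits a -> bounded_digits b ->
  (block_cost (nblocks n).+1 <= n.+1)%N ->
  `|cfr (shiftn (size (insertw a n)).+2 (insert a)) -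
    cfr (shiftn (size (insertw a n)).+2 (insert b)) : R| <=
  2 * 2^-1 ^+ nblocks n.
Proof.
move=> ha hb hn; set N := (size _).+2; set k := nblocks n.
have pa := posseq_shiftn N (insert_posseq (bounded_digits_posseq ha)).
have pb := posseq_shiftn N (insert_posseq (bounded_digits_posseq hb)).
have ea : mkseq (shiftn N (insert a)) k = nseq k 1%N.
  by rewrite /N mkseq_insert_ones.
have eb : mkseq (shiftn N (insert b)) k = nseq k 1%N.
  by rewrite /N (size_insertw_eq a b) mkseq_insert_ones.
rewrite (cfr_mkseq k pa) (cfr_mkseq k pb) ea eb -[X in _ ^+ X](size_nseq k 1%N).
apply: cf_dist_le_pow; [|exact/cfr_itv/posseq_shiftn..].
by rewrite /posw all_nseq orbT.
Qed.

Lemma insert_scrambled a b : bounded_digits a -> bounded_digits b -> a <> b ->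
  scrambled_pair (M := R^o) (X := `[0, 1[) gauss_map (cfr (insert a)) (cfr (insert b)).
Proof.
move=> ha hb ab.
have pa := insert_posseq (bounded_digits_posseq ha).
have pb := insert_posseq (bounded_digits_posseq hb).
pose d p : R := `|cfr (shiftn p (insert a)) - cfr (shiftn p (insert b))|.
rewrite /scrambled_pair (_ : (fun n => _) = (fun n => (d n)%:E)); last first.
  apply/funext => p; rewrite mdist_realE; congr ((`|_ - _|)%:E).
    exact: iter_gauss_map_cfr.
  exact: iter_gauss_map_cfr.
have stage k : exists n, [/\ nblocks n = k, (block_cost (nblocks n).+1 <= n.+1)%N &
    (k <= size (insertw a n))%N].
  have [n [nk hn]] := nblocks_stage k; exists n; split=> //; first by rewrite nk.
  by rewrite (leq_trans _ (size_insertw a n))// -nk nblocks_le.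
have {ab} [j [_ abj]] := first_difference ab.
split.
- have aj : (0 < a j)%N by case/andP: (ha j).
  have bj : (0 < b j)%N by case/andP: (hb j).
  apply: (@limn_esup_gt0 _ _ (2 * ((a j).+1%:R * (b j).+1%:R))^-1).
    by rewrite invr_gt0 !mulr_gt0.
  (* The [p] puts the copy beyond time [p]; the 2 makes [2 * 2^-1 ^+ k] at most 1/2, as
     [inv_natD_gap] requires of the tails. *)
  move=> p; have [k pk kj] := copied_infinitely_often j (p + 2).
  have [n [nk hn kn]] := stage k.
  exists (size (insertw a n)).+1; first by lia.
  rewrite lee_fin /d (cfr_shiftn _ pa) (cfr_shiftn _ pb).
  have -> : insert a (size (insertw a n)).+1 = a j.
    by rewrite insert_copied// nk kj.
  have -> : insert b (size (insertw a n)).+1 = b j.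
    by rewrite (size_insertw_eq a b) insert_copied// nk kj.
  apply: inv_natD_gap => //; try exact/cfr_itv/posseq_shiftn.
  apply: le_trans (insert_common_block ha hb hn) _; rewrite nk.
  have -> : k = (k - 2).+2%N by lia.
  rewrite !exprS; have : (2^-1 : R) ^+ (k - 2)%N <= 1 by rewrite exprn_ile1//; lra.
  lra.
- apply: limn_einf_eq0 => [p|e p e0]; first by rewrite lee_fin /d normr_ge0.
  have [k0 hk0] := geometric2_small e0.
  have [n [nk hn kn]] := stage (maxn p k0).
  exists (size (insertw a n)).+2; first by lia.
  rewrite lee_fin; apply: le_trans (insert_common_block ha hb hn) _.
  apply: le_trans (ltW hk0); rewrite ler_pM2l// nk.
  by apply: ler_wiXn2l; rewrite ?leq_maxr//; lra.
Qed.

End scrambled_insertions.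

(** * Hausdorff dimension *)

Section hausdorff_dimension.
Context {R : realType}.
Local Open Scope ereal_scope.
Implicit Types (A U : set R^o) (s d : R).

Lemma diam_le U d : (0 <= d)%R ->
  (forall x y, U x -> U y -> (`|x - y| <= d)%R) -> diam U <= d%:E.
Proof.
move=> d0 hU; rewrite /diam ge_max lee_fin d0 /=.
apply: ge_ereal_sup => _ [[x y] [/= Ux Uy] <-].
by rewrite mdist_realE lee_fin; exact: hU.
Qed.

Lemma dist_le_diam U (x y : R) : U x -> U y -> `|x - y|%:E <= diam U.
Proof.
move=> Ux Uy; rewrite /diam le_max; apply/orP; right.
by apply: ereal_sup_ubound; exists (x, y) => //=; rewrite mdist_realE.
Qed.

Lemma diam_ge0 U : 0 <= diam U.
Proof. by rewrite /diam le_max lexx. Qed.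

Lemma diam_weight_ge0 s U : 0 <= diam_weight s U.
Proof. by rewrite /diam_weight; case: ifP => // _; exact: poweR_ge0. Qed.

Lemma diam_weight_le s d U : (0 <= s)%R -> (0 <= d)%R -> diam U <= d%:E ->
  diam_weight s U <= (d `^ s)%:E.
Proof.
move=> s0 d0 hU; rewrite /diam_weight; case: ifP => _.
  by rewrite lee_fin powR_ge0.
rewrite -poweR_EFin; apply: gt0_ler_poweR => //.
- by rewrite in_itv /= diam_ge0 leey.
- by rewrite in_itv /= lee_fin d0 leey.
Qed.

Lemma dist_powR_le_diam_weight s U (x y : R) : (0 <= s)%R ->
  U x -> U y -> (`|x - y| `^ s)%:E <= diam_weight s U.
Proof.
move=> s0 Ux Uy; rewrite /diam_weight ifF; last first.
  by apply/negbTE/set0P; exists x.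
rewrite -poweR_EFin; apply: gt0_ler_poweR; rewrite ?in_itv /= ?leey ?andbT//.
- exact: diam_ge0.
- exact: dist_le_diam.
Qed.

Lemma hausdorff_premeasure_ge0 s d A : 0 <= hausdorff_premeasure s d A.
Proof.
apply: le_ereal_inf_tmp => _ [U _ <-].
by apply: nneseries_ge0 => i _ _; exact: diam_weight_ge0.
Qed.

(** The cover consists of [N.+1] intervals of equal length, completed by empty sets of weight 0. *)
Lemma hausdorff_premeasure_unit_le s d (N : nat) A : (0 <= s)%R -> A `<=` `[0%R, 1%R[ ->
  (N.+1%:R^-1 <= d)%R ->
  hausdorff_premeasure s d A <= (N.+1%:R * N.+1%:R^-1 `^ s)%:E.
Proof.
move=> s0 A01 Nd; pose U i : set R^o :=
  if (i < N.+1)%N then `[(i%:R / N.+1%:R)%R, (i.+1%:R / N.+1%:R)%R]%classic else set0.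
have n0 : (0 < N.+1%:R :> R)%R by [].
have diamU i : diam (U i) <= (N.+1%:R^-1)%:E.
  apply: diam_le; first by rewrite invr_ge0.
  rewrite /U; case: ifP => // _ x y; rewrite /= !in_itv /= -(natr1 i) mulrDl mul1r.
  move: (_^-1)%R => q; move: (i%:R * q)%R => p /andP[? ?] /andP[? ?].
  by rewrite ler_norml; lra.
apply: ereal_inf_le; exists (\sum_(0 <= i <oo) diam_weight s (U i)).
  exists U => //; split; last first.
    by move=> i; apply: le_trans (diamU i) _; rewrite lee_fin.
  move=> x /A01; rewrite /= in_itv /= => /andP[x0 x1].
  have xN : (0 <= x * N.+1%:R)%R by rewrite mulr_ge0.
  have /andP[t0 t1] := truncn_itv xN.
  exists (Num.trunc (x * N.+1%:R)) => //; rewrite /U ifT.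
    by rewrite /= in_itv /= ler_pdivrMr// ler_pdivlMr// t0 ltW.
  rewrite -(ltr_nat R); apply: le_lt_trans t0 _.
  by rewrite -[ltRHS]mul1r ltr_pM2r.
rewrite (nneseries_split 0 N.+1); last by move=> i _; exact: diam_weight_ge0.
rewrite add0n [X in _ + X]eseries0 ?adde0; last first.
  by move=> i Ni _; rewrite /U ltnNge Ni /= /diam_weight eqxx.
apply: (@le_trans _ _ (\sum_(0 <= i < N.+1) (N.+1%:R^-1 `^ s)%:E)).
  apply: lee_sum => i _; exact: diam_weight_le.
by rewrite sumEFin lee_fin sumr_const_nat subn0 mulr_natl.
Qed.

Lemma hausdorff_measure_unit_eq0 s A : (1 < s)%R -> A `<=` `[0%R, 1%R[ ->
  hausdorff_measure s A = 0.
Proof.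
move=> s1 A01; have t0 : (0 < s - 1)%R by rewrite subr_gt0.
apply/eqP; rewrite eq_le; apply/andP; split; last first.
  apply: le_trans (hausdorff_premeasure_ge0 s 1 A) _.
  by apply: ereal_sup_ubound; exists 1%R => //=.
apply: ge_ereal_sup => _ [d /= d0 <-].
apply/lee_addgt0Pr => e e0; rewrite add0e.
(* The bound [r <= d] makes the cover admissible, and [r ^ (s - 1) <= e] controls its total weight
   (N + 1)^(1 - s). *)
pose r := Num.min d (e `^ (s - 1)^-1)%R; pose N := Num.trunc r^-1.
have r0 : (0 < r)%R by rewrite /r lt_min d0 powR_gt0.
have n0 : (0 < N.+1%:R :> R)%R by [].
have Nr : (N.+1%:R^-1 <= r)%R.
  by rewrite -[leRHS]invrK lef_pV2 ?posrE ?invr_gt0// ltW// truncnS_gt.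
have [rd re] : (r <= d)%R /\ (r <= e `^ (s - 1)^-1)%R.
  by split; rewrite /r ge_min lexx ?orbT.
have s0 : (0 <= s)%R by lra.
apply: le_trans (hausdorff_premeasure_unit_le s0 A01 (le_trans Nr rd)) _.
rewrite lee_fin -[X in (_ `^ X)%R](subrKC 1%R) powRD; last first.
  by apply/implyP; rewrite invr_neq0.
rewrite powRr1 ?invr_ge0// mulrA mulfV// mul1r.
apply: (@le_trans _ _ ((e `^ (s - 1)^-1) `^ (s - 1))%R).
  by apply: ge0_ler_powR; rewrite ?nnegrE ?invr_ge0 ?powR_ge0 ?(le_trans Nr)// ltW.
by rewrite -powRrM mulVf ?gt_eqF// powRr1// ltW.
Qed.

Lemma hausdorff_dim_unit_le1 A : A `<=` `[0%R, 1%R[ -> hausdorff_dim A <= 1.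
Proof.
move=> A01; apply/lee_addgt0Pr => e e0.
apply: ereal_inf_lbound; exists (1 + e)%R => //; split; first by rewrite addr_ge0// ltW.
by apply: hausdorff_measure_unit_eq0 => //; rewrite ltrDl.
Qed.

Definition inserted : set R^o := [set cfr (insert a) | a in bounded_digits].

Lemma inserted_sub : inserted `<=` `[0%R, 1%R[.
Proof.
move=> _ [a /bounded_digits_posseq/insert_posseq pa <-].
by rewrite /= in_itv /= cfr_lt1// andbT ltW// cfr_gt0.
Qed.

Lemma hausdorff_measure_inserted s : (0 <= s < 1)%R ->
  hausdorff_measure s inserted != 0.
Proof.
move=> hs; have /andP[s0 s1] := hs; have [C C0 hC] := insert_hoelder (R := R) hs.
apply/eqP => H0.
(* Any scale would serve. With total weight below 1/(4C) the pulled-back cover has total length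
   below 1/4, contradicting the 1/2 of [bounded_digits_cover]. *)
have : hausdorff_premeasure s 1 inserted < ((4 * C)^-1)%:E.
  apply: (@le_lt_trans _ _ 0); last by rewrite lte_fin invr_gt0 mulr_gt0.
  by rewrite -H0; apply: ereal_sup_ubound; exists 1%R => //=.
move=> /ereal_inf_lt[_ [U [cover _] <-]] small.
pose X i : set R := [set cfr a | a in [set a | bounded_digits a /\ U i (cfr (insert a))]].
have := @bounded_digits_cover R X (fun i => C%:E * diam_weight s (U i)).
have w0 i : 0 <= diam_weight s (U i) by exact: diam_weight_ge0.
(* This splits the refutation into the four premises of [bounded_digits_cover] and the negation of
   its conclusion. *)
have h : forall P1 P2 P3 P4 Q : Prop, P1 -> P2 -> P3 -> P4 -> ~ Q ->
  ~ (P1 -> P2 -> P3 -> P4 -> Q) by tauto.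
apply: h => [i|i|i _ _ [a [ha Ua] <-] [b [hb Ub] <-]|a ha|].
- move=> _ [a [/bounded_digits_posseq pa _] <-].
  by rewrite /= in_itv /=; exact: cfr_itv.
- by rewrite mule_ge0// lee_fin ltW.
- apply: (@le_trans _ _ (C%:E * (`|cfr (insert a) - cfr (insert b)| `^ s)%:E)).
    by rewrite -EFinM lee_fin; exact: hC.
  by rewrite lee_pmul2l// ?lte_fin//; exact: dist_powR_le_diam_weight.
- have /cover[i _ Ui] : inserted (cfr (insert a)) by exists a.
  by exists i; exists a.
- rewrite nneseriesZl//; apply/negP; rewrite -ltNge.
  apply: (@lt_trans _ _ (C%:E * ((4 * C)^-1)%:E)).
    by rewrite lte_pmul2l// lte_fin.
  rewrite -EFinM lte_fin invfM mulrCA mulfV ?gt_eqF// mulr1.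
  lra.
Qed.

Lemma hausdorff_dim_inserted : hausdorff_dim inserted = 1.
Proof.
apply/eqP; rewrite eq_le hausdorff_dim_unit_le1/=; last exact: inserted_sub.
apply: le_ereal_inf_tmp => _ [s [s0 /eqP hs] <-].
rewrite lee_fin leNgt; apply/negP => s1; move: hs; apply/negP.
by apply: hausdorff_measure_inserted; rewrite s0.
Qed.

End hausdorff_dimension.

Theorem theorem1p3 (R : realType) :
  exists S : set R^o,
    scrambled_set (M := R^o) (X := `[0, 1[) gauss_map S /\
    hausdorff_dim S = 1%E.
Proof.
exists inserted; split; last exact: hausdorff_dim_inserted.
split; first exact: inserted_sub.
(* Every digit bound is at least 8, so the constant sequences 1 and 2 give two points of the set. *)
- have h1 : bounded_digits (fun=> 1%N) by move=> i; rewrite muln_gt0.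
  have h2 : bounded_digits (fun=> 2) by move=> i; rewrite /digit_bound /=; nia.
  exists (cfr (insert (fun=> 1%N))), (cfr (insert (fun=> 2))).
  split; [by exists (fun=> 1%N)|by exists (fun=> 2)|].
  by apply: insert_inj => // /(congr1 (@^~ 0%N)).
- move=> _ _ [a ha <-] [b hb <-] xy; apply: insert_scrambled => // ab.
  by move: xy; rewrite ab eqxx.
Qed.
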